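(* Let $C_0\subset\mathbb{R}^n$ be closed, $F:\mathbb{R}^n\to\mathbb{R}^m$ continuously differentiable, $\bar u\in C_0$, and suppose $\mathrm{rge}\,\nabla F(\bar u)\cap N_{C_0}(\bar u)=\{0\}$. Assume $\nabla F$ is semidifferentiable at $\bar u$ for a unit direction $w\in T_{C_0}(\bar u)$. If for $z\in\mathbb{R}^m$ \[ \big[\,\nabla F(\bar u)z\in N_{C_0}(\bar u)\ \text{ and }\ (\nabla F)'(\bar u;w)z\in\mathrm{rge}\,\nabla F(\bar u)+N_{C_0}(\bar u)\,\big]\Longrightarrow z=0, \] then $F+\varDelta_{C_0}$ is metrically 2-regular around $(\bar u,F(\bar u))$ relative to $w$.
   Context: $\varDelta_{C_0}(x):=\{0\}$ if $x\in C_0$ and $\emptyset$ otherwise. $\nabla F(u)$ is the $n\times m$ transpose of the Jacobian, $\mathrm{rge}$ denotes range; $(\nabla F)'(\bar u;w):=\lim_{\tau\searrow0,w'\to w}(\nabla F(\bar u+\tau w')-\nabla F(\bar u))/\tau$ (semidifferentiable if it exists). Tangent cone $T_Z(x):=\limsup_{\tau\searrow0}(Z-x)/\tau$; limiting normal cone $N_{Z}(\bar x):=\limsup_{x\to\bar x,x\in Z}T_Z(x)^\circ$ with $K^\circ:=\{v\mid v^\top w\le0\ \forall w\in K\}$. $\mathbb{B}$ closed unit ball, $\mathrm{cone}(Z):=\bigcup_{\gamma\ge0}\gamma Z$. Graphical derivative $DS(\bar u|\bar y)(w):=\{v\mid(w,v)\in T_{\mathrm{gph}\,S}(\bar u,\bar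 y)\}$. $S$ is metrically regular around $(u,y)\in\mathrm{gph}\,S$ with constant $c>0$ if there is $\varepsilon>0$ with $\mathrm{dist}[u',S^{-1}(y')]\le c\,\mathrm{dist}[y',S(u')]$ for all $(u',y')\in(u,y)+\varepsilon\mathbb{B}$. $K_{\varepsilon,\delta}(\bar u;w):=\bar u+(\varepsilon\mathbb{B}\cap\mathrm{cone}(w+\delta\mathbb{B}))$. $S$ is metrically 2-regular around $(\bar u,\bar y)$ relative to $w\ne0$ if for some $c>0$ there are $\varepsilon_0,\delta_0,\rho_0>0$ with $\rho_0>\|w\|^{-1}\sup\{\|\eta\|\mid\eta\in DS(\bar u|\bar y)(w)\}$ such that $S$ is metrically regular around $(u,y)$ with constant $c/\|u-\bar u\|$ for all $u\in K_{\varepsilon_0,\delta_0}(\bar u;w)\setminus\{\bar u\}$ and $y\in S(u)\cap(\bar y+\rho_0\|u-\bar u\|\mathbb{B})$. *)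

(* Defs.v *)
From HB Require Import structures.
From mathcomp Require Import all_boot all_order all_algebra.
From mathcomp Require Import all_classical all_reals all_analysis.
Set Implicit Arguments. Unset Strict Implicit. Unset Printing Implicit Defensive.
Import Order.TTheory GRing.Theory Num.Theory.
Import numFieldNormedType.Exports.
Local Open Scope classical_set_scope.
Local Open Scope ring_scope.

Section Defs.
Variable R : realType.

Definition enorm k (v : 'rV[R]_k) : R := Num.sqrt (\sum_i (v 0 i) ^+ 2).
Definition dotv k (v w : 'rV[R]_k) : R := \sum_i v 0 i * w 0 i.

Definition tangent_cone (V : normedModType R) (Z : set V) (x : V) : set V :=
  [set v | forall eps delta : R, 0 < eps -> 0 < delta ->
     exists tau : R, exists v' : V,
       [/\ 0 < tau, tau < delta, `|v' - v| < eps & Z (x + tau *: v')]].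

Definition polar k (K : set 'rV[R]_k) : set 'rV[R]_k :=
  [set v | forall w, K w -> dotv v w <= 0].

Definition normal_cone k (Z : set 'rV[R]_k) (xbar : 'rV[R]_k) : set 'rV[R]_k :=
  [set v | forall eps : R, 0 < eps ->
     exists x, exists v',
       [/\ Z x, `|x - xbar| < eps, polar (tangent_cone Z x) v' & `|v' - v| < eps]].

(* nabla F(u): the n x m transpose of the Jacobian; it acts on z in R^m
   (row convention) by  z *m (nablaF F u)^T ,  and x *m nablaF F u = 'd F u x. *)
Definition nablaF n m (F : 'rV[R]_n -> 'rV[R]_m) (u : 'rV[R]_n) : 'M[R]_(n, m) :=
  lin1_mx ('d F u).

Definition continuously_differentiable n m (F : 'rV[R]_n -> 'rV[R]_m) : Prop :=
  (forall u, differentiable F u) /\ continuous (nablaF F).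

Definition is_semideriv n m (G : 'rV[R]_n -> 'M[R]_(n, m)) (ubar w : 'rV[R]_n)
    (L : 'M[R]_(n, m)) : Prop :=
  forall eps : R, 0 < eps -> exists delta : R, 0 < delta /\
    forall (tau : R) (w' : 'rV[R]_n), 0 < tau -> tau < delta -> `|w' - w| < delta ->
      `|tau^-1 *: (G (ubar + tau *: w') - G ubar) - L| < eps.

Definition semidifferentiable n m (G : 'rV[R]_n -> 'M[R]_(n, m)) ubar w : Prop :=
  exists L, is_semideriv G ubar w L.

(* range of a matrix A : 'M_(n,m) seen as the linear map z |-> A z *)
Definition rge n m (A : 'M[R]_(n, m)) : set 'rV[R]_n := [set z *m A^T | z in [set: 'rV[R]_m]].

Definition minkowski_sum k (A B : set 'rV[R]_k) : set 'rV[R]_k := [set a + b | a in A & b in B].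

(* Set-valued maps and distances (dist to the empty set is +oo). *)
Definition edist k (x : 'rV[R]_k) (A : set 'rV[R]_k) : \bar R :=
  ereal_inf [set (enorm (x - a))%:E | a in A].

Definition inv_map n m (S : 'rV[R]_n -> set 'rV[R]_m) (y : 'rV[R]_m) : set 'rV[R]_n :=
  [set u | S u y].

Definition add_indicator n m (F : 'rV[R]_n -> 'rV[R]_m) (C0 : set 'rV[R]_n) :
    'rV[R]_n -> set 'rV[R]_m :=
  fun u => [set y | C0 u /\ y = F u].

(* metric regularity around (u,y) in gph S with constant c; the neighbourhood
   (u,y) + eps B is taken as the product of closed Euclidean eps-balls. *)
Definition metrically_regular n m (S : 'rV[R]_n -> set 'rV[R]_m) u y (c : R) : Prop :=
  exists eps : R, 0 < eps /\
    forall u' y', enorm (u' - u) <= eps -> enorm (y' - y) <= eps ->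
      (edist u' (inv_map S y') <= c%:E * edist y' (S u'))%E.

Definition graph_deriv n m (S : 'rV[R]_n -> set 'rV[R]_m) ubar ybar (w : 'rV[R]_n)
  : set 'rV[R]_m :=
  [set v | tangent_cone [set p : 'rV[R]_n * 'rV[R]_m | S p.1 p.2] (ubar, ybar) (w, v)].

Definition Kcone n (eps delta : R) (ubar w : 'rV[R]_n) : set 'rV[R]_n :=
  [set u | enorm (u - ubar) <= eps /\
     exists gamma : R, exists z, [/\ 0 <= gamma, enorm (z - w) <= delta & u - ubar = gamma *: z]].

Definition metrically_2_regular n m (S : 'rV[R]_n -> set 'rV[R]_m) ubar ybar
    (w : 'rV[R]_n) : Prop :=
  w != 0 /\
  exists c : R, 0 < c /\
  exists eps0 delta0 rho0 : R, [/\ 0 < eps0, 0 < delta0, 0 < rho0,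
    ((enorm w)^-1%:E * ereal_sup [set (enorm eta)%:E | eta in graph_deriv S ubar ybar w]
       < rho0%:E)%E &
    forall u y, Kcone eps0 delta0 ubar w u -> u != ubar ->
      S u y -> enorm (y - ybar) <= rho0 * enorm (u - ubar) ->
      metrically_regular S u y (c / enorm (u - ubar))].

End Defs.

(* Main.v *)
(* By Mordukhovich's criterion it is enough to bound the coderivatives
   [z |-> z *m (nablaF F x)^T + v], [v] normal to [C0] at [x], from below by
   [a * tau * |z|] at all points [x = ubar + tau w'] of [C0] with [tau] small and
   [w'] close to [w].  If there is no such bound, divide a violating sequence by
   [tau]: the difference quotients of the gradient tend to [L], the rest is
   [p + q] with [p] in the range of the gradient at [ubar] and [q] normal.  After
   scaling by [1 / (1 + |q|)] both converge; the scale cannot vanish in the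
   limit, for then a unit normal would lie in the range, so the limit of [z]
   contradicts the second-order condition.  Conversely a lower bound on the
   coderivatives near [u] gives metric regularity at [u]: a minimiser over [C0]
   of the residual [|F x - y'|] plus a small penalty on [|x - u'|] must solve
   [F x = y'], otherwise its first-order condition violates the bound. *)

Require Import Defs.
From HB Require Import structures.
From mathcomp Require Import all_boot all_order all_algebra.
From mathcomp Require Import all_classical all_reals all_analysis.
From mathcomp Require Import ring lra.
Set Implicit Arguments.
Unset Strict Implicit.
Import Order.TTheory GRing.Theory Num.Theory.
Import numFieldNormedType.Exports.
Local Open Scope classical_set_scope.
Local Open Scope ring_scope.

(** * Entrywise maximum norm of matrices, and limits of products and transposes *)

Lemma mx_entry_le_norm (R : realType) (m n : nat) (A : 'M[R]_(m, n)) i j :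
  `|A i j| <= `|A|.
Proof.
rewrite [leRHS]/Num.norm /= mx_normrE.
by apply: (le_bigmax _ (fun ij : 'I_m * 'I_n => `|A ij.1 ij.2|) (i, j)).
Qed.

Lemma mx_norm_le (R : realType) (m n : nat) (A : 'M[R]_(m, n)) (c : R) :
  0 <= c -> (forall i j, `|A i j| <= c) -> `|A| <= c.
Proof.
move=> c0 Ac; rewrite [leLHS]/Num.norm /= mx_normrE.
by apply: bigmax_le => // -[i j] _; exact: Ac.
Qed.

(** For the entrywise maximum norm, submultiplicativity holds only up to the inner dimension. *)
Lemma norm_mulmx_le (R : realType) (m n p : nat) (A : 'M[R]_(m, n))
  (B : 'M[R]_(n, p)) : `|A *m B| <= n%:R * (`|A| * `|B|).
Proof.
apply: mx_norm_le => [|i j]; first by rewrite !mulr_ge0.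
rewrite mxE; apply: (le_trans (ler_norm_sum _ _ _)).
rewrite mulr_natl -[X in _ *+ X]card_ord -sumr_const; apply: ler_sum => k _.
by rewrite normrM ler_pM // mx_entry_le_norm.
Qed.

Lemma cvg_mulmx (R : realType) (T : Type) (G : set_system T) (FG : Filter G)
  (m n p : nat) (A : T -> 'M[R]_(m, n)) (B : T -> 'M[R]_(n, p))
  (a : 'M[R]_(m, n)) (b : 'M[R]_(n, p)) :
  A @ G --> a -> B @ G --> b -> (fun t => A t *m B t) @ G --> a *m b.
Proof.
move=> Aa Bb; rewrite -subr_cvg0; apply: norm_cvg0.
have nA0 : (fun t => `|A t - a|) @ G --> (0 : R).
  by apply/norm_cvg0P/subr_cvg0.
have nB0 : (fun t => `|B t - b|) @ G --> (0 : R).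
  by apply/norm_cvg0P/subr_cvg0.
have bnd : (fun t => n%:R * (`|A t - a| * `|B t|) + n%:R * (`|a| * `|B t - b|))
    @ G --> (0 : R).
  rewrite -[0 in X in _ --> X](_ : n%:R * (0 * `|b|) + n%:R * (`|a| * 0) = 0); last first.
    by rewrite mul0r !mulr0 addr0.
  apply: cvgD; apply: cvgM; try exact: cvg_cst; apply: cvgM => //.
    exact: cvg_norm.
  exact: cvg_cst.
have cst0 : (fun _ : T => 0 : R) @ G --> (0 : R) by exact: cvg_cst.
apply: (squeeze_cvgr _ cst0 bnd); near=> t.
rewrite normr_ge0 /=.
have -> : A t *m B t - a *m b = (A t - a) *m B t + a *m (B t - b).
  by rewrite mulmxBl mulmxBr addrA subrK.
by apply: (le_trans (ler_normD _ _)); apply: lerD; exact: norm_mulmx_le.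
Unshelve. all: by end_near. Qed.

Lemma cvg_trmx (R : realType) (T : Type) (G : set_system T) (FG : Filter G)
  (m n : nat) (A : T -> 'M[R]_(m, n)) (a : 'M[R]_(m, n)) :
  A @ G --> a -> (fun t => (A t)^T) @ G --> a^T.
Proof.
move=> Aa; apply/cvgrPdist_lt => e e0.
move/cvgrPdist_lt : Aa => /(_ e e0); apply: filterS => t; apply: le_lt_trans.
apply: mx_norm_le => // i j.
by have := mx_entry_le_norm (a - A t) j i; rewrite !mxE.
Qed.

(** * Euclidean norm and inner product, compared with the maximum norm *)

Section Euclidean.
Variable R : realType.

Lemma sqr_enorm k (v : 'rV[R]_k) : enorm v ^+ 2 = dotv v v.
Proof.
rewrite /enorm sqr_sqrtr; last by apply: sumr_ge0 => i _; exact: sqr_ge0.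
by apply: eq_bigr => i _; rewrite expr2.
Qed.

Lemma enorm_ge0 k (v : 'rV[R]_k) : 0 <= enorm v.
Proof. exact: sqrtr_ge0. Qed.

Lemma norm_le_enorm k (v : 'rV[R]_k) : `|v| <= enorm v.
Proof.
apply: mx_norm_le => [|i j]; first exact: enorm_ge0.
rewrite (ord1 i) -sqrtr_sqr /enorm ler_wsqrtr // (bigD1 j) //= lerDl.
by apply: sumr_ge0 => l _; exact: sqr_ge0.
Qed.

(** The crude factor [k.+1] avoids square roots and stays positive when [k = 0], so it can be
    divided by. *)
Lemma enorm_le_norm k (v : 'rV[R]_k) : enorm v <= k.+1%:R * `|v|.
Proof.
rewrite -[leRHS]ger0_norm; last by rewrite mulr_ge0.
rewrite -sqrtr_sqr ler_wsqrtr // exprMn.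
apply: (@le_trans _ _ (k%:R * `|v| ^+ 2)).
  rewrite mulr_natl -[X in _ *+ X]card_ord -sumr_const; apply: ler_sum => i _.
  by rewrite -real_normK ?num_real // lerXn2r ?nnegrE // mx_entry_le_norm.
rewrite ler_wpM2r ?sqr_ge0 // -natrX ler_nat.
by rewrite (leq_trans (leqnSn k)) // -[leqLHS]expn1 leq_pexp2l.
Qed.

Lemma enormZ k (a : R) (v : 'rV[R]_k) : enorm (a *: v) = `|a| * enorm v.
Proof.
rewrite /enorm -sqrtr_sqr -sqrtrM ?sqr_ge0 // mulr_sumr.
by congr Num.sqrt; apply: eq_bigr => i _; rewrite mxE exprMn.
Qed.

Lemma enormN k (v : 'rV[R]_k) : enorm (- v) = enorm v.
Proof. by rewrite -scaleN1r enormZ normrN1 mul1r. Qed.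

Lemma enormB k (v w : 'rV[R]_k) : enorm (v - w) = enorm (w - v).
Proof. by rewrite -enormN opprB. Qed.

Lemma enorm0 k : enorm (0 : 'rV[R]_k) = 0.
Proof. by rewrite -(scale0r 0) enormZ normr0 mul0r. Qed.

Lemma enorm_eq0 k (v : 'rV[R]_k) : (enorm v == 0) = (v == 0).
Proof.
apply/eqP/eqP => [v0|->]; last exact: enorm0.
by apply/eqP; rewrite -normr_le0 -v0 norm_le_enorm.
Qed.

Lemma enorm_continuous k : continuous (@enorm R k).
Proof.
move=> v; apply: (@continuous_comp _ _ _ (fun v : 'rV[R]_k => \sum_i v 0 i ^+ 2)).
  2: exact: sqrt_continuous.
rewrite (_ : (fun _ => _) = \sum_i (fun v : 'rV[R]_k => v 0 i ^+ 2)); last first.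
  by apply/funext => u; rewrite fct_sumE.
apply: (big_ind (fun f : 'rV[R]_k -> R => {for v, continuous f})) => [|f g|i _].
- exact: (@cst_continuous _ _ (0 : R) v).
- exact: continuousD.
apply: (@continuous_comp _ _ _ (fun v : 'rV[R]_k => v 0 i) (fun x => x ^+ 2)).
  exact: coord_continuous.
exact: exprn_continuous.
Qed.

Lemma dotv_mulmx n m (v : 'rV[R]_n) (A : 'M[R]_(n, m)) (z : 'rV[R]_m) :
  dotv (v *m A) z = dotv (z *m A^T) v.
Proof.
rewrite /dotv.
under eq_bigr do rewrite mxE mulr_suml.
under [RHS]eq_bigr do rewrite mxE mulr_suml.
rewrite exchange_big; apply: eq_bigr => i _; apply: eq_bigr => j _.
by rewrite mxE; ring.
Qed.

Lemma dotvZl k (a : R) (v w : 'rV[R]_k) : dotv (a *: v) w = a * dotv v w.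
Proof. by rewrite /dotv mulr_sumr; apply: eq_bigr => i _; rewrite mxE mulrA. Qed.

Lemma dotvDl k (u v w : 'rV[R]_k) : dotv (u + v) w = dotv u w + dotv v w.
Proof.
by rewrite /dotv -big_split; apply: eq_bigr => i _; rewrite mxE mulrDl.
Qed.

Lemma dotvC k (v w : 'rV[R]_k) : dotv v w = dotv w v.
Proof. by apply: eq_bigr => i _; rewrite mulrC. Qed.

End Euclidean.

(** * Compactness through ultrafilters *)

Lemma ultra_fmap (T U : Type) (f : T -> U) (G : set_system T) :
  UltraFilter G -> UltraFilter (f @ G).
Proof.
move=> GU; split; first exact: fmap_proper_filter.
move=> H HP GH; apply/seteqP; split => A; last exact: GH.
move=> HA; have [//|GnA] := in_ultra_setVsetC (f @^-1` A) GU.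
have HnA : H (~` A) by exact: GH.
by exfalso; apply: (@filter_not_empty _ H _); rewrite -(setICr A); apply: filterI.
Qed.

(** Closed balls of ['rV[R]_k] are compact. Limits along one fixed ultrafilter take the place of
    successive extractions of subsequences. *)
Lemma ultra_bounded_cvg (R : realType) (T : Type) (G : set_system T) (k : nat)
  (f : T -> 'rV[R]_k) (M : R) :
  UltraFilter G -> (forall t, `|f t| <= M) ->
  exists l : 'rV[R]_k, f @ G --> l.
Proof.
move=> GU fM; pose B := [set v : 'rV[R]_k | `|v| <= M].
have : compact B.
  apply: bounded_closed_compact.
    by exists M; split; [exact: num_real|move=> x Mx v /= /le_trans; apply; exact: ltW].
  have -> : B = (fun v : 'rV[R]_k => `|v|) @^-1` [set x | x <= M] by [].
  apply: (@preimage_closed _ _ (fun v : 'rV[R]_k => `|v|) [set x | x <= M]).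
    by move=> x _; exact: norm_continuous.
  exact: closed_le.
rewrite compact_ultra => /(_ (f @ G) (ultra_fmap f GU)) [|l [_ fl]].
  by apply: (@filterE _ G) => t; exact: fM.
by exists l.
Qed.

(** * Scaling and closedness of normal cones and ranges *)

Section NormalCones.
Variable R : realType.

Lemma polarZ k (K : set 'rV[R]_k) (a : R) v :
  0 <= a -> polar K v -> polar K (a *: v).
Proof. by move=> a0 Kv w Kw; rewrite dotvZl mulr_ge0_le0 // Kv. Qed.

Lemma normal_coneZ k (Z : set 'rV[R]_k) x (a : R) v :
  0 < a -> normal_cone Z x v -> normal_cone Z x (a *: v).
Proof.
move=> a0 Nv e e0.
have m0 : 0 < Num.min e (e / a) by rewrite lt_min e0 divr_gt0.
have [y [v' [Zy yx Pv' v'v]]] := Nv _ m0.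
exists y, (a *: v'); split => //.
- by apply: (lt_le_trans yx); rewrite ge_min lexx.
- by apply: polarZ => //; exact: ltW.
rewrite -scalerBr normrZ gtr0_norm // mulrC -ltr_pdivlMr //.
by apply: (lt_le_trans v'v); rewrite ge_min lexx orbT.
Qed.

(** The limiting normal cone is an outer limit of polars of tangent cones, so one index far enough
    along the filter supplies the approximating pair. *)
Lemma normal_cone_cvg (T : Type) (G : set_system T) (FG : ProperFilter G) k
  (Z : set 'rV[R]_k) (x v : T -> 'rV[R]_k) (xbar vbar : 'rV[R]_k) :
  (forall t, Z (x t)) -> (forall t, polar (tangent_cone Z (x t)) (v t)) ->
  x @ G --> xbar -> v @ G --> vbar -> normal_cone Z xbar vbar.
Proof.
move=> Zx Pv xl vl e e0.
move/cvgrPdistC_lt : xl => /(_ e e0) xe.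
move/cvgrPdistC_lt : vl => /(_ e e0) ve.
have [t [xt vt]] := filter_ex (filterI xe ve).
by exists (x t), (v t); split.
Qed.

(** The range is closed because it is the kernel of multiplication by [cokermx A^T], a continuous
    map. *)
Lemma rge_cvg (T : Type) (G : set_system T) (FG : ProperFilter G) n m
  (A : 'M[R]_(n, m)) (x : T -> 'rV[R]_n) (xbar : 'rV[R]_n) :
  (forall t, rge A (x t)) -> x @ G --> xbar -> rge A xbar.
Proof.
move=> Ax xl.
have rgeE y : rge A y <-> y *m cokermx A^T = 0.
  split=> [[z _ <-]|/eqP]; first by rewrite -mulmxA mulmx_coker mulmx0.
  by rewrite -submxE => /submxP[z ->]; exists z.
apply/rgeE.
have xC : (fun t => x t *m cokermx A^T) @ G --> xbar *m cokermx A^T.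
  by apply: cvg_mulmx => //; exact: cvg_cst.
have xC0 : (fun t => x t *m cokermx A^T) = (fun=> 0).
  by apply/funext => t; apply/rgeE.
rewrite xC0 in xC.
exact: (norm_cvg_unique (F := _ @ G) xC (cvg_cst 0)).
Qed.

Lemma rgeZ n m (A : 'M[R]_(n, m)) (a : R) x : rge A x -> rge A (a *: x).
Proof. by move=> [z _ <-]; exists (a *: z) => //; rewrite scalemxAl. Qed.

End NormalCones.

(** * Lower bound on coderivatives in directions close to [w] *)

Section CoderivativeBound.
Variables (R : realType) (n m : nat) (C0 : set 'rV[R]_n).
Variables (J : 'rV[R]_n -> 'M[R]_(n, m)) (ubar w : 'rV[R]_n) (L : 'M[R]_(n, m)).
Hypothesis J_continuous : {for ubar, continuous J}.
Hypothesis J_semideriv : is_semideriv J ubar w L.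
Hypothesis rge_normal0 :
  forall v, rge (J ubar) v -> normal_cone C0 ubar v -> v = 0.
Hypothesis second_order : forall z : 'rV[R]_m,
  normal_cone C0 ubar (z *m (J ubar)^T) ->
  minkowski_sum (rge (J ubar)) (normal_cone C0 ubar) (z *m L^T) -> z = 0.

(** The limit passage of the contradiction argument. Along an ultrafilter the rescaled normal parts
    converge without further extraction. *)
Lemma directional_limit_eq0 (T : Type) (G : set_system T) (tau : T -> R)
  (w' v : T -> 'rV[R]_n) (z : T -> 'rV[R]_m) (zbar : 'rV[R]_m) :
  UltraFilter G -> (forall t, 0 < tau t) -> tau @ G --> (0 : R) ->
  w' @ G --> w -> z @ G --> zbar ->
  (forall t, C0 (ubar + tau t *: w' t)) ->
  (forall t, polar (tangent_cone C0 (ubar + tau t *: w' t)) (v t)) ->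
  (fun t => (tau t)^-1 *: (z t *m (J (ubar + tau t *: w' t))^T + v t)) @ G
    --> (0 : 'rV[R]_n) ->
  zbar = 0.
Proof.
move=> GU tau_gt0 tau0 w'w zz uC vP res0.
pose u t := ubar + tau t *: w' t.
have u_cvg : u @ G --> ubar.
  have : u @ G --> ubar + 0 *: w; last by rewrite scale0r addr0.
  by apply: cvgD; [exact: cvg_cst|exact: cvgZ].
have J_cvg : (fun t => J (u t)) @ G --> J ubar.
  by apply: (cvg_comp _ _ u_cvg); exact: J_continuous.
pose D t := (tau t)^-1 *: (J (u t) - J ubar).
have D_cvg : D @ G --> L.
  apply/cvgrPdistC_lt => e e0.
  have [d [d0 dP]] := J_semideriv e0.
  move/cvgrPdistC_lt : tau0 => /(_ d d0) taud.
  move/cvgrPdistC_lt : w'w => /(_ d d0) w'd.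
  apply: filterS2 taud w'd => t; rewrite subr0 => taut w't.
  by apply: dP => //; rewrite -[tau t]gtr0_norm.
pose q t := (tau t)^-1 *: v t.
pose p t := (tau t)^-1 *: (z t *m (J ubar)^T).
pose r t := (tau t)^-1 *: (z t *m (J (u t))^T + v t).
(* Substitute [J (u t) = J ubar + tau t *: D t] into the residual. *)
have rE t : r t = p t + z t *m (D t)^T + q t.
  rewrite /r /p /q /D linearZ /= -scalemxAr -!scalerDr linearB /= mulmxBr.
  by rewrite addrC -addrA [in RHS]addrA subrKC addrC.
(* Since [tau t *: r t] tends to 0, the normals tend to minus the limit of [z t *m (J (u t))^T].
   Because of this sign the second-order condition is applied to [- zbar]. *)
have v_cvg : v @ G --> - zbar *m (J ubar)^T.
  have vE : v = (fun t => tau t *: r t - z t *m (J (u t))^T).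
    apply/funext => t; rewrite /r scalerA divff ?gt_eqF // scale1r.
    by rewrite [X in X - _]addrC addrK.
  have : v @ G --> 0 *: (0 : 'rV[R]_n) - zbar *m (J ubar)^T; last first.
    by rewrite scale0r add0r mulNmx.
  rewrite vE; apply: cvgB; first exact: cvgZ.
  by apply: cvg_mulmx => //; exact: cvg_trmx.
have Nz : normal_cone C0 ubar (- zbar *m (J ubar)^T).
  exact: normal_cone_cvg uC vP u_cvg v_cvg.
(* With this scale [s t *: q t] has norm [1 - s t], so it is bounded, and its limit [qbar] also
   determines the limit of [s]. *)
pose s t := (1 + `|q t|)^-1.
have q1 t : 0 < 1 + `|q t| by rewrite ltr_wpDr.
have s_gt0 t : 0 < s t by rewrite invr_gt0.
have sq_norm t : `|s t *: q t| = 1 - s t.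
  by rewrite normrZ gtr0_norm // /s; field; exact: lt0r_neq0.
have [qbar q_cvg] : exists l : 'rV[R]_n, (fun t => s t *: q t) @ G --> l.
  apply: (@ultra_bounded_cvg _ _ _ _ _ 1) => t.
  by rewrite sq_norm gerBl ltW.
have s_cvg : s @ G --> 1 - `|qbar|.
  have -> : s = (fun t => 1 - `|s t *: q t|).
    by apply/funext => t; rewrite sq_norm subKr.
  by apply: cvgB; [exact: cvg_cst|exact: cvg_norm].
have Nq : normal_cone C0 ubar qbar.
  apply: normal_cone_cvg uC _ u_cvg q_cvg => t.
  rewrite /q scalerA; apply: polarZ; last exact: vP.
  by apply: mulr_ge0; rewrite ?invr_ge0 ltW.
have p_cvg : (fun t => s t *: p t) @ G -->
    - qbar - (1 - `|qbar|) *: (zbar *m L^T).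
  have pE : (fun t => s t *: p t) =
      (fun t => s t *: r t - s t *: q t - s t *: (z t *m (D t)^T)).
    by apply/funext => t; rewrite rE !scalerDr addrK addrK.
  have : (fun t => s t *: p t) @ G -->
      (1 - `|qbar|) *: 0 - qbar - (1 - `|qbar|) *: (zbar *m L^T); last first.
    by rewrite scaler0 add0r.
  rewrite pE.
  apply: cvgB; first by apply: cvgB => //; exact: cvgZ.
  by apply: cvgZ => //; apply: cvg_mulmx => //; exact: cvg_trmx.
have Rp : rge (J ubar) (- qbar - (1 - `|qbar|) *: (zbar *m L^T)).
  apply: rge_cvg p_cvg => t; apply: rgeZ; apply: rgeZ.
  by exists (z t).
have s_ge0 : 0 <= 1 - `|qbar|.
  by apply: (cvgr_to_ge s_cvg); apply: nearW => t; exact: ltW.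
(* If the scale vanishes in the limit, [qbar] has norm 1 but is both normal and in the range.
   Otherwise dividing by [1 - |qbar|] writes [- zbar *m L^T] as a range element plus a normal. *)
move: s_ge0; rewrite le_eqVlt => /orP[/eqP s0|s0].
  have q0 : qbar = 0.
    apply: rge_normal0 => //; move: Rp; rewrite -s0 scale0r subr0.
    by move=> /(rgeZ (-1)); rewrite scaleN1r opprK.
  by move: s0; rewrite q0 normr0 subr0 => /esym/eqP; rewrite oner_eq0.
apply/eqP; rewrite -oppr_eq0; apply/eqP; apply: second_order => //.
exists ((1 - `|qbar|)^-1 *: (- qbar - (1 - `|qbar|) *: (zbar *m L^T))).
  exact: rgeZ.
exists ((1 - `|qbar|)^-1 *: qbar).
  by apply: normal_coneZ; rewrite ?invr_gt0.
by rewrite -scalerDr addrAC addNr add0r scalerN scalerA mulVf ?gt_eqF // scale1r mulNmx.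
Qed.

Lemma directional_coderivative_bound : exists a r : R,
  [/\ 0 < a, 0 < r & forall (tau : R) (w' v : 'rV[R]_n) (z : 'rV[R]_m),
    0 < tau -> tau < r -> `|w' - w| < r -> C0 (ubar + tau *: w') ->
    polar (tangent_cone C0 (ubar + tau *: w')) v ->
    a * tau * `|z| <= `|z *m (J (ubar + tau *: w'))^T + v|].
Proof.
apply: contrapT => nbound.
(* The estimate is positively homogeneous in [(z, v)], so a violation can be normalised to
   [|z| = 1]. *)
pose bad (k : nat) (x : R * 'rV[R]_n * 'rV[R]_n * 'rV[R]_m) :=
  let: (tau, w', v, z) := x in
  [/\ 0 < tau /\ tau < k.+1%:R^-1, `|w' - w| < k.+1%:R^-1,
      C0 (ubar + tau *: w') /\ polar (tangent_cone C0 (ubar + tau *: w')) v,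
      `|z| = 1 &
      `|tau^-1 *: (z *m (J (ubar + tau *: w'))^T + v)| < k.+1%:R^-1].
have /choice[x xP] : forall k, exists x, bad k x.
  move=> k; apply: contrapT => nbad; apply: nbound.
  exists k.+1%:R^-1, k.+1%:R^-1; split => // tau w' v z tau0 tauk w'k uC vP.
  rewrite leNgt; apply/negP => small; apply: nbad.
  (* A violation has [z] nonzero, since the left side of the estimate vanishes at [z = 0]. *)
  have z0 : 0 < `|z|.
    rewrite normr_gt0; apply: contraTneq small => ->.
    by rewrite normr0 mulr0 -leNgt.
  exists (tau, w', `|z|^-1 *: v, `|z|^-1 *: z); split => //.
  - by split => //; apply: polarZ => //; rewrite invr_ge0.
  - by rewrite normrZ gtr0_norm ?invr_gt0 // mulVf // gt_eqF.
  rewrite -scalemxAl -scalerDr !normrZ !gtr0_norm ?invr_gt0 //.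
  rewrite mulrCA ltr_pdivrMl // ltr_pdivrMl // .
  by rewrite [X in _ < X](_ : _ = k.+1%:R^-1 * tau * `|z|) //; ring.
(* Any ultrafilter finer than the eventual filter will do: [k.+1%:R^-1] still tends to 0 along
   it. *)
have [G [GU oG]] := ultraFilterLemma (@eventually_filter).
pose tau k := (x k).1.1.1; pose w' k := (x k).1.1.2.
pose v k := (x k).1.2; pose z k := (x k).2.
have {}xP k : bad k (tau k, w' k, v k, z k).
  by have := xP k; rewrite /tau /w' /v /z; case: (x k) => [[[]]].
have inv0 : (fun k : nat => k.+1%:R^-1 : R) @ G --> (0 : R).
  move=> A /(@cvg_harmonic R) hA; exact: oG.
have small_cvg (V : normedModType R) (f : nat -> V) :
    (forall k, `|f k| < k.+1%:R^-1) -> f @ G --> (0 : V).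
  move=> fk; apply/cvgr0Pnorm_lt => e e0.
  move/cvgr0Pnorm_lt : inv0 => /(_ e e0); apply: filterS => k.
  by rewrite gtr0_norm ?invr_gt0 //; apply: lt_trans.
have [zbar z_cvg] : exists l : 'rV[R]_m, z @ G --> l.
  apply: (@ultra_bounded_cvg _ _ _ _ _ 1) => k.
  by have [_ _ _ -> _] := xP k.
have z1 : `|zbar| = 1.
  have zn : (fun k => `|z k|) @ G --> `|zbar| by exact: cvg_norm.
  have zE : (fun k => `|z k|) = (fun=> 1).
    by apply/funext => k; have [_ _ _ -> _] := xP k.
  rewrite zE in zn.
  exact: (norm_cvg_unique (F := _ @ G) zn (cvg_cst (1 : R))).
suff z0 : zbar = 0 by move: z1; rewrite z0 normr0 => /esym/eqP; rewrite oner_eq0.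
apply: (@directional_limit_eq0 _ G tau w' v z) => //.
- by move=> k; have [[]] := xP k.
- by apply: small_cvg => k; have [[t0 tk] _ _ _ _] := xP k; rewrite gtr0_norm.
- by apply/subr_cvg0; apply: small_cvg => k; have [] := xP k.
- by move=> k; have [_ _ []] := xP k.
- by move=> k; have [_ _ []] := xP k.
- by apply: small_cvg => k; have [] := xP k.
Qed.

End CoderivativeBound.

(** * First-order expansions and necessary conditions on tangent directions *)

Lemma diff_directional (R : realType) (V W : normedModType R) (f : V -> W)
  (x v : V) (e : R) :
  differentiable f x -> 0 < e ->
  exists2 del : R, 0 < del & forall (tau : R) (v' : V),
    0 < tau -> tau < del -> `|v' - v| < del ->
    `|f (x + tau *: v') - f x - tau *: 'd f x v| <= tau * e.
Proof.
move=> df e0.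
have c0 : 0 < `|v| + 1 by rewrite ltr_wpDl.
have e1 : 0 < e / (2 * (`|v| + 1)) by rewrite divr_gt0 // mulr_gt0.
(* Half of the error [e] pays for the remainder at [tau *: v'], where [|v'| < |v| + 1]; the other
   half pays for replacing [v'] by [v] in the differential. *)
move: (diff_locally df) => /eqaddoP/(_ _ e1)/nbhs_ballP[rho /= rho0 small].
have : {for v, continuous ('d f x)} by exact: diff_continuous.
have e2 : 0 < e / 2 by rewrite divr_gt0.
move=> /cvgrPdist_lt /(_ _ e2)/nbhs_ballP[eta /= eta0 close].
exists (Num.min (Num.min eta 1) (rho / (`|v| + 1))).
  by rewrite !lt_min eta0 ltr01 divr_gt0.
move=> tau v' tau0; rewrite !lt_min => /andP[_ taud] /andP[/andP[v'eta v'1] _].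
have v'n : `|v'| < `|v| + 1.
  rewrite -[v'](subrK v) addrC; apply: (le_lt_trans (ler_normD _ _)).
  by rewrite ltrD2l.
have hn : `|tau *: v'| <= tau * (`|v| + 1).
  by rewrite normrZ gtr0_norm // ler_pM2l // ltW.
have /small hs : ball 0 rho (tau *: v').
  rewrite -ball_normE /= sub0r normrN; apply: (le_lt_trans hn).
  by rewrite -ltr_pdivlMr.
have {hs} hs : `|f (tau *: v' + x) - (f x + tau *: 'd f x v')|
    <= e / (2 * (`|v| + 1)) * `|tau *: v'|.
  have dZ : 'd f x (tau *: v') = tau *: 'd f x v' by rewrite linearZ.
  by rewrite -dZ; exact: hs.
have /close hc : ball v eta v' by rewrite -ball_normE /= distrC.
have -> : f (x + tau *: v') - f x - tau *: 'd f x v =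
    (f (tau *: v' + x) - (f x + tau *: 'd f x v'))
      - tau *: ('d f x v - 'd f x v').
  by rewrite scalerBr opprB opprD !addrA subrK [tau *: v' + x]addrC.
apply: (le_trans (ler_normB _ _)).
rewrite [leRHS](_ : _ = e / (2 * (`|v| + 1)) * (tau * (`|v| + 1)) + tau * (e / 2)).
  apply: lerD; first by apply: (le_trans hs); rewrite ler_pM2l.
  by rewrite normrZ gtr0_norm // ler_pM2l // ltW.
by field; rewrite gt_eqF.
Qed.

(** Were the derivative negative, tangency would give points [x + tau *: v'] of [Z] near [x] whose
    first-order error is at most half of the predicted decrease, contradicting minimality. *)
Lemma tangent_first_order (R : realType) (V : normedModType R) (Z : set V)
  (g : V -> R) (x v : V) (r : R) :
  differentiable g x -> 0 < r ->
  (forall y, Z y -> `|y - x| < r -> g x <= g y) ->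
  tangent_cone Z x v -> 0 <= 'd g x v.
Proof.
move=> dg r0 gmin Zv; rewrite leNgt; apply/negP => neg.
have e0 : 0 < - 'd g x v / 2 by rewrite divr_gt0 // oppr_gt0.
have [del del0 gdel] := diff_directional v dg e0.
have c0 : 0 < `|v| + 1 by rewrite ltr_wpDl.
have m0 : 0 < Num.min del 1 by rewrite lt_min del0 ltr01.
have d0 : 0 < Num.min del (r / (`|v| + 1)) by rewrite lt_min del0 divr_gt0.
have [tau [v' [tau0]]] := Zv _ _ m0 d0.
rewrite !lt_min => /andP[taud taur] /andP[v'd v'1] Zy.
have v'n : `|v'| <= `|v| + 1.
  rewrite -[v'](subrK v) addrC; apply: (le_trans (ler_normD _ _)).
  by rewrite lerD2l ltW.
have := gdel _ _ tau0 taud v'd; rewrite /GRing.scale /= => gy.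
have {}gy := le_trans (ler_norm _) gy.
have gx : g x <= g (x + tau *: v').
  apply: gmin => //; rewrite addrAC subrr add0r normrZ gtr0_norm //.
  apply: (@le_lt_trans _ _ (tau * (`|v| + 1))); first by rewrite ler_pM2l.
  by rewrite -ltr_pdivlMr.
have : 0 <= tau * 'd g x v by lra.
by rewrite pmulr_rge0 // leNgt neg.
Qed.

Lemma differentiable_sqr_norm (R : realType) (V : normedModType R) (m : nat)
  (G : V -> 'rV[R]_m) (x v : V) :
  differentiable G x ->
  differentiable (fun y => dotv (G y) (G y)) x /\
  'd (fun y => dotv (G y) (G y)) x v = 2 * dotv ('d G x v) (G x).
Proof.
move=> dG.
have coordE i : differentiable (fun y => G y 0 i) x /\
    'd (fun y => G y 0 i) x v = 'd G x v 0 i.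
  (* Coordinate evaluation is packaged as a linear map, so that it is its own differential in the
     chain rule. *)
  have @f : {linear 'rV[R]_m -> R}.
    by exists (fun N : 'rV[R]_m => N 0 i); do 2![eexists]; do ?[constructor];
       rewrite ?mxE// => ? *; rewrite ?mxE//; move=> ?; rewrite !mxE.
  have df y : differentiable f y by exact: differentiable_coord.
  rewrite (_ : (fun y => G y 0 i) = f \o G) //; split.
    exact: differentiable_comp.
  have fE : 'd f (G x) = f :> ('rV[R]_m -> R).
    by apply: diff_lin; exact: coord_continuous.
  by rewrite diff_comp //= fE.
pose h i := fun y => G y 0 i * G y 0 i.
have dh i : differentiable (h i) x.
  by have [? _] := coordE i; exact: differentiableM.
rewrite (_ : (fun y => dotv (G y) (G y)) = \sum_(i < m) h i); last first.
  by apply/funext => y; rewrite fct_sumE.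
have ds : differentiable (\sum_(i < m) h i) x by exact: differentiable_sum.
split => //; rewrite -deriveE // derive_sum; last first.
  by move=> i; exact: diff_derivable.
rewrite /dotv mulr_sumr; apply: eq_bigr => i _.
have [di dE] := coordE i.
by rewrite deriveE // diffM // mulrA -mulrAC -dE -mulrA mulr_natl mulr2n.
Qed.

Lemma diff_subr_cst (R : realType) (V W : normedModType R) (G : V -> W) (c : W)
  (x v : V) :
  differentiable G x ->
  differentiable (fun y => G y - c) x /\ 'd (fun y => G y - c) x v = 'd G x v.
Proof.
move=> dG; have dc : differentiable (cst c : V -> W) x by exact: differentiable_cst.
have dGc : differentiable (fun y => G y - c) x by exact: (differentiableB dG dc).
split; first exact: dGc.
rewrite -(deriveE v dGc) -(deriveE v dG).
have := deriveB (diff_derivable (v := v) dG) (diff_derivable (v := v) dc).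
by rewrite derive_cst subr0.
Qed.

(** * Metric regularity from a coderivative bound *)

Section MetricRegularity.
Variables (R : realType) (n m : nat) (C0 : set 'rV[R]_n).
Variable F : 'rV[R]_n -> 'rV[R]_m.
Hypothesis C0_closed : closed C0.
Hypothesis F_diff : forall x, differentiable F x.

Lemma nablaFE x v : v *m nablaF F x = 'd F x v.
Proof. exact: mul_rV_lin1. Qed.

(* The penalty is quadratic so that it stays differentiable at [u']; by AM-GM
   the residual norm may be replaced by its square divided by twice its value
   at the minimiser, which gives a smooth function with the same minimiser. *)
Lemma approximate_preimage (u' : 'rV[R]_n) (y' : 'rV[R]_m) (alpha r kappa : R) :
  C0 u' -> 0 < kappa -> 3 * m.+1%:R <= kappa * alpha ->
  y' != F u' -> kappa * enorm (y' - F u') < r ->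
  (forall x v z, C0 x -> `|x - u'| < r -> polar (tangent_cone C0 x) v ->
     alpha * `|z| <= `|z *m (nablaF F x)^T + v|) ->
  exists x, [/\ C0 x, F x = y' & enorm (u' - x) <= kappa * enorm (y' - F u')].
Proof.
move=> Cu' k0 ka y'F kr bound.
set d := enorm (y' - F u') in kr *.
have d0 : 0 < d by rewrite lt_def enorm_ge0 enorm_eq0 subr_eq0 y'F.
have kd0 : 0 < kappa * d by rewrite mulr_gt0.
have sub_cont k (c : 'rV[R]_k) : continuous (fun x : 'rV[R]_k => x - c).
  move=> x; apply: (@continuousB _ _ _ id (fun=> c)); first exact: cvg_id.
  exact: cst_continuous.
(* The midpoint leaves room on both sides: minimisers turn out to lie within [kappa * d] of [u'],
   and the compact set stays where [bound] applies. *)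
pose rho := (kappa * d + r) / 2.
have rho1 : kappa * d < rho by rewrite /rho; lra.
have rho2 : rho < r by rewrite /rho; lra.
(* This weight makes a penalty of at most [d] equivalent to [enorm (x - u') <= kappa * d], and then
   bounds the penalty gradient by [2 / kappa]. *)
pose b := (kappa ^+ 2 * d)^-1.
have b0 : 0 < b by rewrite invr_gt0 mulr_gt0 // exprn_gt0.
pose g x := enorm (F x - y') + b * enorm (x - u') ^+ 2.
pose K := C0 `&` [set x | `|x - u'| <= rho].
have Kcompact : compact K.
  apply: bounded_closed_compact.
    exists (rho + `|u'|); split; first exact: num_real.
    move=> M ltM x [_ /= xu]; apply: le_trans (ltW ltM).
    by rewrite -[x in `|x|](subrK u'); apply: (le_trans (ler_normD _ _)); rewrite lerD2r.
  apply: closedI => //.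
  apply: (@preimage_closed _ _ (fun x : 'rV[R]_n => `|x - u'|) [set t | t <= rho]).
    move=> x _; apply: (@continuous_comp _ _ _ (fun x : 'rV[R]_n => x - u')).
      exact: sub_cont.
    exact: norm_continuous.
  exact: closed_le.
have g_cont : {within K, continuous g}.
  apply: continuous_subspaceT => x.
  apply: (@continuousD _ _ _ (fun x => enorm (F x - y'))
    (fun x => b * enorm (x - u') ^+ 2)).
    apply: (@continuous_comp _ _ _ (fun x => F x - y')); last exact: enorm_continuous.
    apply: (@continuous_comp _ _ _ F (fun y => y - y')); last exact: sub_cont.
    exact: differentiable_continuous.
  apply: (@continuousM R 'rV[R]_n (fun=> b) (fun x => enorm (x - u') ^+ 2) x).
    exact: cst_continuous.
  apply: (@continuous_comp 'rV[R]_n R R (fun x => enorm (x - u')) (fun t => t ^+ 2)).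
    apply: (@continuous_comp _ _ _ (fun x : 'rV[R]_n => x - u')); last exact: enorm_continuous.
    exact: sub_cont.
  exact: exprn_continuous.
have Ku' : K u' by split => //=; rewrite subrr normr0; lra.
have [x /set_mem[Cx /= xu] xmin] := EVT_min_rV (ex_intro _ u' Ku') Kcompact g_cont.
(* Compare with the competitor [u'], where the penalty vanishes. *)
have gx : g x <= d.
  have := xmin u' (mem_set Ku'); rewrite {2}/g subrr.
  by rewrite enorm0 expr0n mulr0 addr0 enormB.
have xd : enorm (x - u') <= kappa * d.
  rewrite -ler_sqr ?nnegrE ?enorm_ge0 ?(ltW kd0) //.
  have : b * enorm (x - u') ^+ 2 <= d.
    by apply: le_trans gx; rewrite lerDr enorm_ge0.
  rewrite mulrC ler_pdivrMr ?mulr_gt0 ?exprn_gt0 //.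
  by rewrite (_ : d * (kappa ^+ 2 * d) = (kappa * d) ^+ 2) //; ring.
exists x; split => //; last by rewrite enormB.
apply/eqP; apply: contraT => Fxy.
pose phi := enorm (F x - y').
have phi0 : 0 < phi by rewrite lt_def enorm_ge0 enorm_eq0 subr_eq0 Fxy.
pose h1 x := dotv (F x - y') (F x - y').
pose h2 x := dotv (x - u') (x - u').
pose h := (2 * phi)^-1 \*: h1 + b \*: h2.
have [dFy _] := diff_subr_cst y' 0 (F_diff x).
have dFyE v : 'd (fun x => F x - y') x v = v *m nablaF F x.
  by have [_ ->] := diff_subr_cst y' v (F_diff x); rewrite nablaFE.
have did : differentiable (@id 'rV[R]_n) x by [].
have [dxu _] := diff_subr_cst u' 0 did.
have dxuE v : 'd (fun x : 'rV[R]_n => x - u') x v = v.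
  by have [_ ->] := diff_subr_cst u' v did; rewrite -deriveE // derive_id.
have dh1 : differentiable h1 x by have [] := differentiable_sqr_norm 0 dFy.
have dh2 : differentiable h2 x by have [] := differentiable_sqr_norm 0 dxu.
have dh : differentiable h x by apply: differentiableD; exact: differentiableZ.
have dhE v : 'd h x v = phi^-1 * dotv (v *m nablaF F x) (F x - y')
    + 2 * b * dotv v (x - u').
  have [_ E1] := differentiable_sqr_norm v dFy.
  have [_ E2] := differentiable_sqr_norm v dxu.
  have -> : 'd h x v = (2 * phi)^-1 * 'd h1 x v + b * 'd h2 x v.
    rewrite -!deriveE // /h deriveD; try exact/diff_derivable/differentiableZ.
    by rewrite !deriveZ //; exact: diff_derivable.
  rewrite E1 E2 dFyE dxuE; field; exact: lt0r_neq0.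
have hmin y : C0 y -> `|y - x| < rho - kappa * d -> h x <= h y.
  move=> Cy yx.
  have /mem_set/xmin : K y.
    split => //=; rewrite -(subrK x y) -addrA.
    apply: (le_trans (ler_normD _ _)).
    by have := le_trans (norm_le_enorm (x - u')) xd; lra.
  rewrite /g -/phi; set psi := enorm (F y - y') => gxy.
  have hE t : h t = (2 * phi)^-1 * enorm (F t - y') ^+ 2 + b * enorm (t - u') ^+ 2.
    by rewrite !sqr_enorm.
  rewrite !hE -/phi -/psi.
  (* Hence [h + phi / 2] dominates [g], with equality at [x], and minimality passes from [g] to
     [h]. *)
  have : psi <= (2 * phi)^-1 * psi ^+ 2 + phi / 2.
    rewrite -subr_ge0 (_ : _ - _ = (2 * phi)^-1 * (psi - phi) ^+ 2).
      by rewrite mulr_ge0 ?sqr_ge0 // invr_ge0 mulr_ge0 // ltW.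
    by field; exact: lt0r_neq0.
  have -> : (2 * phi)^-1 * phi ^+ 2 = phi / 2 by field; exact: lt0r_neq0.
  lra.
(* [z] is the Euclidean unit residual and [v] represents minus the differential of [h] at [x].
   First-order optimality puts [v] in the polar, and in [z *m (nablaF F x)^T + v] only the penalty
   gradient survives. *)
pose z := phi^-1 *: (F x - y').
pose v := - (z *m (nablaF F x)^T + (2 * b) *: (x - u')).
have vP : polar (tangent_cone C0 x) v.
  move=> t Tt; have rk : 0 < rho - kappa * d by lra.
  have := tangent_first_order dh rk hmin Tt.
  have zE : dotv (z *m (nablaF F x)^T) t =
      phi^-1 * dotv ((F x - y') *m (nablaF F x)^T) t.
    by rewrite /z -scalemxAl dotvZl.
  rewrite dhE dotv_mulmx /v -[- (_ + _)]scaleN1r dotvZl dotvDl dotvZl zE (dotvC t).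
  lra.
have xr : `|x - u'| < r by exact: le_lt_trans xu rho2.
have := bound x v z Cx xr vP.
rewrite /v opprD addrA subrr add0r normrN => az.
have {}az : alpha * `|z| <= 2 / kappa.
  apply: (le_trans az); apply: (le_trans (norm_le_enorm _)).
  rewrite enormZ gtr0_norm ?mulr_gt0 //.
  apply: (@le_trans _ _ (2 * b * (kappa * d))); first by rewrite ler_pM2l ?mulr_gt0.
  by rewrite /b le_eqVlt; apply/orP; left; apply/eqP; field; rewrite !gt_eqF.
(* The contradiction is [3 <= 3 * m.+1%:R * |z| <= kappa * alpha * |z| <= 2]. *)
have z1 : 1 <= m.+1%:R * `|z|.
  apply: le_trans (enorm_le_norm _).
  by rewrite enormZ gtr0_norm ?invr_gt0 // mulVf // gt_eqF.
have kaz : kappa * alpha * `|z| <= 2.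
  by rewrite -mulrA mulrC -ler_pdivlMr.
have : 3 * (m.+1%:R * `|z|) <= 2.
  by rewrite mulrA; apply: le_trans kaz; apply: ler_wpM2r.
lra.
Qed.

(** By continuity of [F], for [(u', y')] near [(u, F u)] the residual at [u'] is so small that
    [approximate_preimage] applies on a ball around [u'] inside the given one. *)
Lemma metrically_regular_of_bound (u : 'rV[R]_n) (alpha r kappa : R) :
  0 < r -> 0 < kappa -> 3 * m.+1%:R <= kappa * alpha ->
  (forall x v z, C0 x -> `|x - u| < r -> polar (tangent_cone C0 x) v ->
     alpha * `|z| <= `|z *m (nablaF F x)^T + v|) ->
  metrically_regular (add_indicator F C0) u (F u) kappa.
Proof.
move=> r0 k0 ka bound.
(* The residual will have maximum norm below [2 * eta], and
   [kappa * m.+1%:R * (2 * eta) = r / 2]. *)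
pose eta := r / (4 * kappa * m.+1%:R).
have eta0 : 0 < eta by rewrite divr_gt0 // !mulr_gt0.
have /cvgrPdist_lt/(_ _ eta0)/nbhs_ballP[del /= del0 Fdel] :
  F @ u --> F u by exact: differentiable_continuous.
pose eps := Num.min (Num.min (r / 2) eta) (del / 2).
have eps0 : 0 < eps by rewrite !lt_min eta0 !divr_gt0.
have [er ee ed] : [/\ eps <= r / 2, eps <= eta & eps < del].
  by split; rewrite /eps ?ge_min ?gt_min ?lexx ?orbT //; apply/orP; right; lra.
exists eps; split => // u' y' u'u y'y.
(* Off [C0] the value is empty, so the right-hand distance is [+oo]. *)
have [Cu'|nCu'] := pselect (C0 u'); last first.
  have -> : add_indicator F C0 u' = set0 by apply/seteqP; split => y [].
  by rewrite [X in (_ <= _ * X)%E]/Defs.edist image_set0 ereal_inf0 gt0_muley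
    ?lte_fin // leey.
have -> : Defs.edist y' (add_indicator F C0 u') = (enorm (y' - F u'))%:E.
  rewrite /Defs.edist (_ : add_indicator F C0 u' = [set F u']).
    by rewrite image_set1 ereal_inf1.
  by apply/seteqP; split => y /= [] //; move=> ->.
suff [x [Cx Fx ux]] : exists x, [/\ C0 x, F x = y' &
    enorm (u' - x) <= kappa * enorm (y' - F u')].
  apply: (@le_trans _ _ (enorm (u' - x))%:E); last by rewrite lee_fin.
  by apply: ereal_inf_lbound; exists x.
have [->|y'F] := eqVneq y' (F u').
  exists u'; split => //.
  by rewrite !subrr !enorm0 mulr0.
have uu : `|u' - u| <= eps by exact: le_trans (norm_le_enorm _) u'u.
have yy : `|y' - F u| <= eps by exact: le_trans (norm_le_enorm _) y'y.
have FF : `|F u - F u'| < eta.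
  by apply: Fdel; rewrite -ball_normE /= distrC; exact: le_lt_trans uu ed.
apply: (@approximate_preimage _ _ alpha (r / 2)) => //.
  have yF : `|y' - F u'| < 2 * eta.
    by rewrite -(subrK (F u) y') -addrA; apply: (le_lt_trans (ler_normD _ _)); lra.
  have e2 := enorm_le_norm (y' - F u').
  apply: (@le_lt_trans _ _ (kappa * (m.+1%:R * `|y' - F u'|))).
    by rewrite ler_pM2l.
  rewrite mulrA -ltr_pdivlMl ?mulr_gt0 //; apply: (lt_le_trans yF).
  have M0 : 0 < m.+1%:R :> R by [].
  rewrite /eta; move: (m.+1%:R : R) M0 => M M0.
  by rewrite le_eqVlt; apply/orP; left; apply/eqP; field; rewrite !gt_eqF.
move=> x v z Cx xu; apply: bound => //.
by rewrite -(subrK u' x) -addrA; apply: (le_lt_trans (ler_normD _ _)); lra.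
Qed.

End MetricRegularity.

(** * Graphical derivative of the constrained map, and metric 2-regularity *)

Lemma graph_deriv_diff (R : realType) (n m : nat) (C0 : set 'rV[R]_n)
  (F : 'rV[R]_n -> 'rV[R]_m) (x w : 'rV[R]_n) (v : 'rV[R]_m) :
  differentiable F x ->
  graph_deriv (add_indicator F C0) x (F x) w v -> v = 'd F x w.
Proof.
move=> dF Tv; apply/eqP; rewrite -subr_eq0 -normr_le0.
apply/ler_addgt0Pl => e e0; rewrite addr0.
have e2 : 0 < e / 2 by rewrite divr_gt0.
have [del del0 Fdel] := diff_directional w dF e2.
have m0 : 0 < Num.min del (e / 2) by rewrite lt_min del0.
have [tau [[w' v'] [tau0 taud]]] := Tv _ _ m0 del0.
rewrite prod_normE /= gt_max => /andP[w'w v'v] [_ /= Fy].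
move: w'w v'v; rewrite !lt_min => /andP[w'd _] /andP[_ v'e].
(* Membership in the graph makes [v'] the difference quotient of [F] along [w'], hence close to
   ['d F x w]. *)
have {}Fy : F (x + tau *: w') = F x + tau *: v' by exact: esym Fy.
have := Fdel _ _ tau0 taud w'd.
rewrite Fy [F x + _]addrC addrK -scalerBr normrZ gtr0_norm // ler_pM2l // => v'F.
rewrite -(subrK v' v) -addrA; apply: (le_trans (ler_normD _ _)).
by rewrite distrC in v'e; lra.
Qed.

Unset Implicit Arguments.

Theorem theorem9 (R : realType) (n m : nat) (C0 : set 'rV[R]_n)
  (F : 'rV[R]_n -> 'rV[R]_m) (ubar w : 'rV[R]_n) (L : 'M[R]_(n, m)) :
  closed C0 ->
  continuously_differentiable F ->
  C0 ubar ->
  (forall v, rge (nablaF F ubar) v -> normal_cone C0 ubar v -> v = 0) ->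
  enorm w = 1 ->
  tangent_cone C0 ubar w ->
  is_semideriv (nablaF F) ubar w L ->
  (forall z : 'rV[R]_m,
     normal_cone C0 ubar (z *m (nablaF F ubar)^T) ->
     minkowski_sum (rge (nablaF F ubar)) (normal_cone C0 ubar) (z *m L^T) ->
     z = 0) ->
  metrically_2_regular (add_indicator F C0) ubar (F ubar) w.
Proof.
move=> C0_closed [F_diff J_cont] _ rge0 w1 _ J_semi second.
have w_neq0 : w != 0 by rewrite -enorm_eq0 w1 oner_eq0.
have [a [r [a0 r0 bound]]] :=
  directional_coderivative_bound (J_cont ubar) J_semi rge0 second.
have W0 : 0 < `|w| by rewrite normr_gt0.
have W1 : `|w| <= 1 by rewrite -w1 norm_le_enorm.
pose M : R := m.+1%:R; have M0 : 0 < M by [].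
pose N : R := n.+1%:R; have N0 : 0 < N by [].
(* Regularity at [u] needs modulus [3 * M / (a * gam)], and [enorm (u - ubar) <= 2 * N * gam];
   together they give [6 * M * N / a]. *)
have c0 : 0 < 6 * M * N / a by rewrite divr_gt0 // !mulr_gt0.
(* The bound [r / 2] leaves half of the tolerance on directions for moving from [u] to [x]; the
   bound [|w| / 2] keeps [|z|] between [|w| / 2] and 2. *)
pose delta0 := Num.min (r / 2) (`|w| / 2).
have [d0 dr dw] : [/\ 0 < delta0, delta0 <= r / 2 & delta0 <= `|w| / 2].
  by split; rewrite /delta0 ?lt_min ?ge_min ?lexx ?orbT // !divr_gt0.
split => //; exists (6 * M * N / a); split => //.
(* The first radius forces [gam <= r / 2], through [|z| >= |w| / 2]. The last one exceeds the
   supremum, as the graphical derivative contains at most ['d F ubar w]. *)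
exists (r * `|w| / 4), delta0, (enorm ('d F ubar w) + 1); split => //.
- by rewrite divr_gt0 // mulr_gt0.
- by rewrite ltr_wpDl // enorm_ge0.
- rewrite w1 invr1 mul1e.
  apply: (@le_lt_trans _ _ (enorm ('d F ubar w))%:E); last by rewrite lte_fin ltrDl.
  apply: ge_ereal_sup => _ [v /(graph_deriv_diff (F_diff ubar)) -> <-].
  exact: lexx.
move=> u y [uE [gam [z [gam_ge0 zw uz]]]] u_neq [Cu ->] _.
have uu : 0 < enorm (u - ubar) by rewrite lt_def enorm_ge0 enorm_eq0 subr_eq0 u_neq.
have gam0 : 0 < gam.
  rewrite lt_def gam_ge0 andbT; apply: contraTneq uu => g0.
  by rewrite uz g0 scale0r enorm0 ltxx.
have zwn : `|z - w| <= delta0 by exact: le_trans (norm_le_enorm _) zw.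
have z_ge : `|w| / 2 <= `|z|.
  by have := ler_normD z (w - z); rewrite subrKC distrC; lra.
have z_le : `|z| <= 2.
  by have := ler_normD w (z - w); rewrite subrKC; lra.
have gamr : gam < r.
  have : gam * `|z| <= r * `|w| / 4.
    apply: le_trans uE; apply: le_trans (norm_le_enorm _).
    by rewrite uz normrZ gtr0_norm.
  move=> gz; have {}gz : gam * (`|w| / 2) <= r * `|w| / 4.
    by apply: le_trans gz; rewrite ler_pM2l.
  have : gam * `|w| <= r / 2 * `|w| by lra.
  by rewrite ler_pM2r // => ?; lra.
have uN : enorm (u - ubar) <= 2 * N * gam.
  rewrite uz enormZ gtr0_norm // mulrC ler_pM2r //.
  by apply: (le_trans (enorm_le_norm z)); rewrite -/N mulrC ler_pM2r.
(* The cone parameter [gam] plays the role of [tau]: the coderivative bound near [u] is [a * gam],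
   on a ball whose radius shrinks in proportion to [gam]. *)
apply: (@metrically_regular_of_bound _ _ _ _ _ C0_closed F_diff u (a * gam) (gam * (r / 2))).
- by rewrite mulr_gt0 // divr_gt0.
- by rewrite divr_gt0.
- rewrite -/M mulrAC ler_pdivlMr //.
  apply: (@le_trans _ _ (3 * M * (2 * N * gam))); first by rewrite ler_pM2l // mulr_gt0.
  by rewrite le_eqVlt; apply/orP; left; apply/eqP; field; exact: lt0r_neq0.
move=> x v zeta Cx xu vP.
(* Using the parameter [gam] of [u] for [x] as well gives [w' - w = gam^-1 *: (x - u) + (z - w)],
   with the first term below [r / 2] and the second at most [r / 2]. *)
pose w' := gam^-1 *: (x - ubar).
have xE : ubar + gam *: w' = x by rewrite scalerA divff ?gt_eqF // scale1r subrKC.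
have w'w : `|w' - w| < r.
  have -> : w' - w = gam^-1 *: (x - u) + (z - w).
    have -> : z = gam^-1 *: (u - ubar) by rewrite uz scalerA mulVf ?gt_eqF // scale1r.
    by rewrite addrA -scalerDr addrA subrK.
  apply: (le_lt_trans (ler_normD _ _)).
  have : `|gam^-1 *: (x - u)| < r / 2.
    by rewrite normrZ gtr0_norm ?invr_gt0 // ltr_pdivrMl.
  lra.
by have := bound gam w' v zeta gam0 gamr w'w; rewrite xE; apply.
Qed.
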